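(* $$\sum_{k=1}^\infty\frac{3^k}{k^2\binom{2k}{k}}\left(6S_1(2k)-10S_1(k)+\frac7k\right)=2\sqrt3\,\pi K.$$
   Context: $S_1(n):=\sum_{i=1}^n \frac1i$ is the $n$-th harmonic number. $K:=2c_1-\frac{4\pi^2}{27}+2$, where $c_1:=\sum_{i=1}^\infty\frac{1}{(1+3i)^2}$. *)

(* Defs.v *)
From Stdlib Require Import Reals.
From Coquelicot Require Import Coquelicot.

Open Scope R_scope.

Definition S1 (n : nat) : R := sum_n_m (fun i : nat => 1 / INR i) 1 n.

(* [Series] sums from 0, whence the shift [S i] for a sum starting at i = 1.
   It converges, so the total operator [Series] gives its actual sum. *)
Definition c1 : R := Series (fun i : nat => 1 / (1 + 3 * INR (S i)) ^ 2).

Definition K : R := 2 * c1 - 4 * PI ^ 2 / 27 + 2.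

(* [Binomial.C] is the real-valued binomial coefficient; the bare name [C] is
   Coquelicot's type of complex numbers. *)
Definition summand (k : nat) : R :=
  3 ^ k / (INR k ^ 2 * Binomial.C (2 * k) k)
  * (6 * S1 (2 * k) - 10 * S1 k + 7 / INR k).

(* Main.v *)
Require Import Defs.
From Stdlib Require Import Reals Lra Lia Nsatz Binomial.
From Coquelicot Require Import Coquelicot.
Open Scope R_scope.

(** Let [w k] be the harmonic factor of the summand and, for [|x| < 4],
[f x = sum_(k >= 1) w k x^k / (k^2 C(2k,k))]; the sum in question is [f 3].
The substitution [x = 4 sin^2 t] sends [x = 3] to [t = PI/3].  The ratio of
consecutive terms [1 / (k C(2k,k))] is rational in [k], and so is the
increment [w (k+1) - w k]; these recurrences turn into first-order
differential equations for the generating series, which in the variable [t]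
reduce to
<<
  (d/dt)^2 f(4 sin^2 t) = 24 t cot t - 32 t tan t
>>
([inv_binom_ode], [weighted_ode], [rho_spec], [is_derive_dlifted_sum]).  With
the coefficients 6, -10, 7 the increment has only the denominators [2k + 1] and
[k], which the recurrence of the terms clears; the harmonic numbers then enter
the second equation only through the forcing term [12 - 7x] times the series
of [inv_binom].

Hence [f(4 sin^2 a)] is the integral over [0, a] of
[(a - t) t (24 cot t - 32 tan t)].  The partial sums
[sum_(n <= N) (48 + 64 (-1)^n) sin 2nt] differ from [24 cot t - 32 tan t] by
a Dirichlet kernel oscillating at frequency [2N + 1] ([dirichlet_sine]), and
the Riemann-Lebesgue lemma gives ([lifted_sum_fourier])
<<
  f(4 sin^2 a) = sum_n (12 + 16 (-1)^n)
                       ((1 - cos 2na) / n^3 - a sin 2na / n^2).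
>>
Integrals enter only through explicit antiderivatives: [riemann_lebesgue]
bounds the increment of a function with oscillating derivative, by the mean
value theorem.

At [a = PI/3] doubling [n] fixes [cos 2na] and negates [sin 2na], so each
alternating sum is a multiple of the plain one ([psum_alternating]).  The
cubic part gets the coefficient [12 + 16 * (-3/4) = 0] and disappears.  The
quadratic part gives [4 PI sum_n sin(2 n PI/3) / n^2], that is
[2 sqrt 3 PI (alpha - beta)], where [alpha] and [beta] are the sums of
[1/n^2] over [n = 1] and [n = 2] modulo 3.  Finally
[alpha + beta = 4 PI^2 / 27], by the same kernel argument applied to
[sum_n (-1)^n (1 - cos 2na) / n^2 = - a^2] ([square_fourier]); as
[alpha = 1 + c1], this says [alpha - beta = K]. *)

(** * Coefficients and their recurrences *)

(** The index is shifted by one: [inv_binom n] belongs to the term [k = n + 1]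
of the sum, so that the power series start with a nonzero constant term. *)
Definition inv_binom (n : nat) : R :=
  / (INR (S n) * Binomial.C (2 * S n) (S n)).

Definition weight (n : nat) : R :=
  6 * S1 (2 * S n) - 10 * S1 (S n) + 7 / INR (S n).
Definition weighted (n : nat) : R := weight n * inv_binom n.

Lemma S1_S (n : nat) : S1 (S n) = S1 n + 1 / INR (S n).
Proof. unfold S1. rewrite sum_n_Sm by lia. reflexivity. Qed.

Lemma S1_1 : S1 1 = 1.
Proof. unfold S1. rewrite sum_n_n. simpl. field. Qed.

Lemma central_binomial_S (n : nat) :
  INR (S n) * Binomial.C (2 * S n) (S n)
  = 2 * (2 * INR n + 1) * Binomial.C (2 * n) n.
Proof.
  unfold Binomial.C.
  replace (2 * S n - S n)%nat with (S n) by lia.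
  replace (2 * n - n)%nat with n by lia.
  replace (2 * S n)%nat with (S (S (2 * n))) by lia.
  rewrite !fact_simpl, !mult_INR, !S_INR, mult_INR. simpl (INR 2).
  pose proof (INR_fact_neq_0 n). pose proof (pos_INR n).
  field. split; [assumption | lra].
Qed.

Lemma central_binomial_pos (n : nat) : 0 < Binomial.C (2 * n) n.
Proof.
  unfold Binomial.C. pose proof INR_fact_lt_0.
  apply Rdiv_lt_0_compat; [| apply Rmult_lt_0_compat]; auto.
Qed.

Lemma inv_binom_0 : inv_binom 0 = / 2.
Proof.
  unfold inv_binom. rewrite central_binomial_S. unfold Binomial.C. simpl. field.
Qed.

(** Multiplying out the ratio of consecutive central binomial coefficients;
this recurrence is what becomes [inv_binom_ode]. *)
Lemma inv_binom_S (n : nat) :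
  2 * (2 * INR (S n) + 1) * inv_binom (S n) = INR (S n) * inv_binom n.
Proof.
  unfold inv_binom. rewrite (central_binomial_S (S n)).
  pose proof (central_binomial_pos (S n)). pose proof (pos_INR (S n)).
  pose proof (lt_0_INR (S n) (Nat.lt_0_succ n)).
  field. repeat split; lra.
Qed.

Lemma inv_binom_pos (n : nat) : 0 < inv_binom n.
Proof.
  apply Rinv_0_lt_compat, Rmult_lt_0_compat.
  - apply lt_0_INR; lia.
  - apply central_binomial_pos.
Qed.

Lemma weight_0 : weight 0 = 6.
Proof.
  unfold weight. change (2 * 1)%nat with 2%nat. rewrite (S1_S 1), S1_1. simpl.
  field.
Qed.

Lemma weight_S (n : nat) :
  weight (S n) = weight n + 6 / (2 * INR (S n) + 1) - 7 / INR (S n).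
Proof.
  unfold weight. replace (2 * S (S n))%nat with (S (S (2 * S n))) by lia.
  rewrite (S1_S (S (2 * S n))), (S1_S (2 * S n)), (S1_S (S n)).
  rewrite !(S_INR (S _)), (S_INR (2 * S n)), mult_INR. simpl (INR 2).
  pose proof (lt_0_INR (S n) (Nat.lt_0_succ n)).
  field. lra.
Qed.

(** The recurrence of [inv_binom] carries over to [weighted] up to
[weight (n+1) - weight n = 6 / (2n+3) - 7 / (n+1)], whose two denominators are
the two factors of that recurrence: they cancel and leave no denominator. *)
Lemma weighted_S (n : nat) :
  2 * (2 * INR (S n) + 1) * weighted (S n) - INR (S n) * weighted n
  = 12 * inv_binom (S n) - 7 * inv_binom n.
Proof.
  unfold weighted.
  pose proof (lt_0_INR (S n) (Nat.lt_0_succ n)) as Hn.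
  replace (12 * inv_binom (S n) - 7 * inv_binom n) with
    (12 * inv_binom (S n) - 7 / INR (S n) * (INR (S n) * inv_binom n))
    by (field; lra).
  replace (INR (S n) * (weight n * inv_binom n))
    with (weight n * (INR (S n) * inv_binom n)) by ring.
  rewrite <- inv_binom_S, weight_S. field. lra.
Qed.

Lemma inv_binom_bound (n : nat) : inv_binom n <= (/ 4) ^ n.
Proof.
  induction n as [|n IH]; [rewrite inv_binom_0; simpl; lra|].
  pose proof (inv_binom_S n) as E. pose proof (inv_binom_pos n).
  pose proof (lt_0_INR (S n) (Nat.lt_0_succ n)) as Hn.
  pose proof (inv_binom_pos (S n)). simpl pow. nra.
Qed.

Lemma weight_bound (n : nat) : Rabs (weight n) <= 7 * INR (S n).
Proof.
  induction n as [|n IH].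
  { rewrite weight_0, Rabs_pos_eq by lra. simpl. lra. }
  assert (H : 1 <= INR (S n)) by (rewrite S_INR; pose proof (pos_INR n); lra).
  assert (0 <= 6 / (2 * INR (S n) + 1) <= 6).
  { split; [apply Rcomplements.Rdiv_le_0_compat; lra|].
    apply Rcomplements.Rle_div_l; [lra|]. nra. }
  assert (0 <= 7 / INR (S n) <= 7).
  { split; [apply Rcomplements.Rdiv_le_0_compat; lra|].
    apply Rcomplements.Rle_div_l; [lra|]. nra. }
  rewrite weight_S. rewrite (S_INR (S n)). apply Rabs_le_between in IH.
  apply Rabs_le_between. lra.
Qed.

(** * The generating series and their differential equations *)

Lemma CV_radius_le (a b : nat -> R) :
  (forall n, Rabs (a n) <= Rabs (b n)) -> Rbar_le (CV_radius b) (CV_radius a).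
Proof.
  intros H. apply (CV_radius_bounded b). intros x [M HM].
  apply (CV_radius_bounded a). exists M. intros n.
  apply Rle_trans with (2 := HM n). rewrite !Rabs_mult.
  apply Rmult_le_compat_r; [apply Rabs_pos | apply H].
Qed.

(** The majorant [(n+1) / 4^n] is the derivative of the geometric series, whose
radius is given by the ratio test; the ratio test does not apply directly to
[weighted], whose terms could vanish. *)
Lemma CV_radius_geom4 (a : nat -> R) (x : R) :
  (forall n, Rabs (a n) <= 7 * INR (S n) * (/ 4) ^ n) ->
  Rabs x < 4 -> Rbar_lt (Rabs x) (CV_radius a).
Proof.
  intros Ha Hx.
  set (b := fun n : nat => (/ 4) ^ n).
  assert (Hb : CV_radius b = 4).
  { replace (Finite 4) with (Finite (/ / 4)) by (f_equal; field).
    apply CV_radius_finite_DAlembert; [| lra |].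
    - intros n. apply pow_nonzero. lra.
    - apply is_lim_seq_ext with (fun _ => / 4); [| apply is_lim_seq_const].
      intros n. unfold b. simpl.
      assert ((/ 4) ^ n <> 0) by (apply pow_nonzero; lra).
      replace (/ 4 * (/ 4) ^ n / (/ 4) ^ n) with (/ 4) by (field; lra).
      rewrite Rabs_pos_eq; lra. }
  apply Rbar_lt_le_trans with 4; [exact Hx|].
  rewrite <- Hb, <- CV_radius_incr_1, <- CV_radius_derive.
  rewrite <- (CV_radius_scal 7) by lra.
  apply CV_radius_le. intros n. apply Rle_trans with (1 := Ha n).
  unfold PS_scal, PS_derive, PS_incr_1, b.
  change (7 * INR (S n) * (/ 4) ^ n <= Rabs (7 * (INR (S n) * (/ 4) ^ n))).
  rewrite <- Rmult_assoc. apply Rle_abs.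
Qed.

Lemma inv_binom_radius (x : R) :
  Rabs x < 4 -> Rbar_lt (Rabs x) (CV_radius inv_binom).
Proof.
  apply CV_radius_geom4. intros n.
  rewrite Rabs_pos_eq by (apply Rlt_le, inv_binom_pos).
  assert (0 < (/ 4) ^ n) by (apply pow_lt; lra).
  pose proof (inv_binom_bound n). rewrite S_INR. pose proof (pos_INR n). nra.
Qed.

Lemma weighted_radius (x : R) :
  Rabs x < 4 -> Rbar_lt (Rabs x) (CV_radius weighted).
Proof.
  apply CV_radius_geom4. intros n. unfold weighted.
  rewrite Rabs_mult, (Rabs_pos_eq (inv_binom n))
    by (apply Rlt_le, inv_binom_pos).
  apply Rmult_le_compat.
  - apply Rabs_pos.
  - apply Rlt_le, inv_binom_pos.
  - apply weight_bound.
  - apply inv_binom_bound.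
Qed.

(** The recurrence operator [a |-> 2 (2n+1) a_n - n a_(n-1)] on coefficients is
a differential operator on series.  At [n = 0] the factor [INR n] kills the
out-of-range term. *)
Lemma pseries_operator (a : nat -> R) (x : R) :
  Rbar_lt (Rabs x) (CV_radius a) ->
  is_pseries (fun n => 2 * (2 * INR n + 1) * a n - INR n * a (pred n)) x
    ((4 * x - x ^ 2) * PSeries (PS_derive a) x + (2 - x) * PSeries a x).
Proof.
  intros Hx.
  assert (H0 : is_pseries a x (PSeries a x)).
  { apply PSeries_correct, CV_radius_inside, Hx. }
  assert (H1 : is_pseries (PS_incr_1 (PS_derive a)) x
                 (x * PSeries (PS_derive a) x)).
  { apply (is_pseries_incr_1 (PS_derive a) x), PSeries_correct,
      ex_pseries_derive, Hx. }
  pose proof (is_pseries_plus _ _ _ _ _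
    (is_pseries_plus _ _ _ _ _
      (is_pseries_scal 4 _ _ _ (Rmult_comm _ _) H1)
      (is_pseries_scal 2 _ _ _ (Rmult_comm _ _) H0))
    (is_pseries_scal (-1) _ _ _ (Rmult_comm _ _)
      (is_pseries_incr_1 _ x _ (is_pseries_plus _ _ _ _ _ H0 H1)))) as H.
  match type of H with is_pseries _ _ ?l =>
    replace ((4 * x - x ^ 2) * PSeries (PS_derive a) x + (2 - x) * PSeries a x)
      with l by (unfold plus, scal; simpl; unfold mult; simpl; ring) end.
  apply is_pseries_ext with (2 := H).
  intros n. unfold PS_plus, PS_scal, PS_incr_1, PS_derive.
  unfold plus, scal, zero; simpl. unfold mult; simpl.
  destruct n as [|[|n]].
  - simpl. ring.
  - simpl. ring.
  - simpl. ring.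
Qed.

Lemma inv_binom_ode (x : R) : Rabs x < 4 ->
  (4 * x - x ^ 2) * PSeries (PS_derive inv_binom) x
  + (2 - x) * PSeries inv_binom x
  = 1.
Proof.
  intros Hx.
  pose proof (pseries_operator inv_binom x (inv_binom_radius x Hx)) as H.
  rewrite <- (is_pseries_unique _ _ _ H).
  rewrite PSeries_decr_1 by (eexists; exact H).
  rewrite (PSeries_ext _ (fun _ => 0)).
  - rewrite PSeries_const_0, inv_binom_0. simpl. field.
  - intros n. unfold PS_decr_1. rewrite inv_binom_S. simpl pred. ring.
Qed.

(** The constant terms agree because [2 * weight 0 = 12]. *)
Lemma weighted_ode (x : R) : Rabs x < 4 ->
  (4 * x - x ^ 2) * PSeries (PS_derive weighted) x
  + (2 - x) * PSeries weighted x
  = (12 - 7 * x) * PSeries inv_binom x.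
Proof.
  intros Hx.
  assert (H0 : is_pseries inv_binom x (PSeries inv_binom x)).
  { apply PSeries_correct, CV_radius_inside, inv_binom_radius, Hx. }
  pose proof (is_pseries_plus _ _ _ _ _
      (is_pseries_scal 12 _ _ _ (Rmult_comm _ _) H0)
      (is_pseries_scal (-7) _ _ _ (Rmult_comm _ _)
        (is_pseries_incr_1 _ x _ H0))) as H.
  rewrite <- (is_pseries_unique _ _ _
    (pseries_operator weighted x (weighted_radius x Hx))).
  transitivity
    (12 * PSeries inv_binom x + (-7) * (x * PSeries inv_binom x)); [|ring].
  apply is_pseries_unique. apply is_pseries_ext with (2 := H).
  intros n. unfold PS_plus, PS_scal, PS_incr_1.
  unfold plus, scal, zero; simpl. unfold mult; simpl.
  destruct n as [|n].
  - unfold weighted. rewrite weight_0. simpl. ring.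
  - simpl pred. rewrite weighted_S. ring.
Qed.

(** * Sums from 1 and differentiation *)

Definition psum (f : nat -> R) (N : nat) : R := sum_n_m f 1 N.

Lemma psum_0 (f : nat -> R) : psum f 0 = 0.
Proof. unfold psum. rewrite sum_n_m_zero by lia. reflexivity. Qed.

Lemma psum_S (f : nat -> R) (N : nat) : psum f (S N) = psum f N + f (S N).
Proof. unfold psum. rewrite sum_n_Sm by lia. reflexivity. Qed.

Lemma psum_ext (f g : nat -> R) (N : nat) :
  (forall n, (1 <= n)%nat -> f n = g n) -> psum f N = psum g N.
Proof. intros H. apply sum_n_m_ext_loc. intros n Hn. apply H, Hn. Qed.

Lemma psum_scal (c : R) (f : nat -> R) (N : nat) :
  psum (fun n => c * f n) N = c * psum f N.
Proof. apply (sum_n_m_mult_l c f). Qed.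

Lemma psum_double_S (f : nat -> R) (M : nat) :
  psum f (2 * S M)
  = psum f (2 * M) + f (S (2 * M)) + f (S (S (2 * M))).
Proof.
  replace (2 * S M)%nat with (S (S (2 * M))) by lia. now rewrite !psum_S.
Qed.

Lemma is_derive_psum (f df : nat -> R -> R) (t : R) (N : nat) :
  (forall n, (1 <= n)%nat -> is_derive (f n) t (df n t)) ->
  is_derive (fun s => psum (fun n => f n s) N) t (psum (fun n => df n t) N).
Proof.
  intros H. induction N as [|N IH].
  - apply is_derive_ext with (fun _ => 0).
    + intros s. now rewrite psum_0.
    + rewrite psum_0. apply @is_derive_const.
  - apply is_derive_ext with (fun s => psum (fun n => f n s) N + f (S N) s).
    + intros s. now rewrite psum_S.
    + rewrite psum_S. apply @is_derive_plus with (1 := IH). apply H. lia.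
Qed.

Lemma pow_neg1_double (M : nat) : (-1) ^ (2 * M) = 1.
Proof. rewrite pow_mult. replace ((-1) ^ 2) with 1 by ring. apply pow1. Qed.

(** Riemann-Lebesgue for [D a - D 0], the integral of [D'] over [0, a], with a
bound uniform in [D] and [m].  Integration by parts: subtracting
[(p sin mt - q cos mt) / m] from [D] leaves a function whose derivative is
[O(1/m)], to which the mean value theorem applies. *)
Lemma riemann_lebesgue (p q dp dq : R -> R) (a : R) :
  0 <= a ->
  (forall t, 0 <= t <= a -> is_derive p t (dp t)) ->
  (forall t, 0 <= t <= a -> is_derive q t (dq t)) ->
  (forall t, 0 <= t <= a -> continuous dp t) ->
  (forall t, 0 <= t <= a -> continuous dq t) ->
  exists B, forall (m : R) (D : R -> R), 0 < m ->
    (forall t, 0 <= t <= a ->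
       is_derive D t (p t * cos (m * t) + q t * sin (m * t))) ->
    Rabs (D a - D 0) <= B / m.
Proof.
  intros Ha Hp Hq Hdp Hdq.
  destruct (bounded_continuity dp 0 a Hdp) as [Bp HBp].
  destruct (bounded_continuity dq 0 a Hdq) as [Bq HBq].
  exists ((Bp + Bq) * a + (Rabs (p a) + Rabs (q a) + Rabs (p 0) + Rabs (q 0))).
  intros m D Hm HD.
  set (E := fun t => (p t * sin (m * t) - q t * cos (m * t)) / m).
  set (dE := fun t => (dp t * sin (m * t) - dq t * cos (m * t)) / m
                      + (p t * cos (m * t) + q t * sin (m * t))).
  assert (HE : forall t, 0 <= t <= a -> is_derive E t (dE t)).
  { intros t Ht. unfold E, dE. pose proof (Hp t Ht). pose proof (Hq t Ht).
    auto_derive.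
    - repeat split; eexists; eassumption.
    - replace (Derive (fun x => p x) t) with (dp t)
        by (symmetry; apply is_derive_unique, Hp, Ht).
      replace (Derive (fun x => q x) t) with (dq t)
        by (symmetry; apply is_derive_unique, Hq, Ht).
      field. lra. }
  assert (Hs : forall t, Rabs (sin t) <= 1)
    by (intros t; apply Rabs_le, SIN_bound).
  assert (Hc : forall t, Rabs (cos t) <= 1)
    by (intros t; apply Rabs_le, COS_bound).
  assert (Hlin : forall u v t, Rabs (u * sin t - v * cos t) <= Rabs u + Rabs v).
  { intros u v t.
    apply Rle_trans with (1 := Rabs_triang _ _).
    rewrite Rabs_Ropp, !Rabs_mult.
    pose proof (Hs t). pose proof (Hc t).
    pose proof (Rabs_pos u). pose proof (Rabs_pos v). nra. }
  assert (Hdiv : forall u, Rabs (u / m) = Rabs u / m).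
  { intros u. unfold Rdiv. rewrite Rabs_mult.
    rewrite (Rabs_pos_eq (/ m)); [reflexivity|].
    left. now apply Rinv_0_lt_compat. }
  assert (HEb : forall t, Rabs (E t) <= (Rabs (p t) + Rabs (q t)) / m).
  { intros t. unfold E. rewrite Hdiv. apply Rmult_le_compat_r, Hlin.
    left. now apply Rinv_0_lt_compat. }
  destruct (MVT_gen (fun t => D t - E t) 0 a
    (fun t => - ((dp t * sin (m * t) - dq t * cos (m * t)) / m)))
    as (c & Hc0 & Hmvt).
  { rewrite Rmin_left, Rmax_right by lra. intros t Ht.
    replace (- _) with (minus (p t * cos (m * t) + q t * sin (m * t)) (dE t)).
    - apply @is_derive_minus; [apply HD | apply HE]; lra.
    - unfold dE, minus, plus, opp; simpl. ring. }
  { rewrite Rmin_left, Rmax_right by lra. intros t Ht.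
    apply continuity_pt_filterlim, @continuous_minus;
      apply @ex_derive_continuous; eexists; [apply HD | apply HE]; lra. }
  rewrite Rmin_left, Rmax_right in Hc0 by lra.
  assert (HB : Rabs ((D a - E a) - (D 0 - E 0)) <= (Bp + Bq) * a / m).
  { rewrite Hmvt, Rabs_mult, Rabs_Ropp, Hdiv, Rminus_0_r, (Rabs_pos_eq a Ha).
    replace ((Bp + Bq) * a / m) with ((Bp + Bq) / m * a) by (field; lra).
    apply Rmult_le_compat_r; [exact Ha|].
    apply Rmult_le_compat_r; [left; now apply Rinv_0_lt_compat|].
    apply Rle_trans with (1 := Hlin _ _ _).
    pose proof (HBp c Hc0) as H1. pose proof (HBq c Hc0) as H2.
    change (Rabs (dp c) < Bp) in H1. change (Rabs (dq c) < Bq) in H2. lra. }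
  replace (D a - D 0) with ((D a - E a - (D 0 - E 0)) + (E a + - E 0)) by ring.
  apply Rle_trans with (1 := Rabs_triang _ _).
  pose proof (Rabs_triang (E a) (- E 0)) as Ht. rewrite Rabs_Ropp in Ht.
  pose proof (HEb a). pose proof (HEb 0).
  unfold Rdiv in *. rewrite !Rmult_plus_distr_r in *. lra.
Qed.

(** * Dirichlet kernels *)

(** Summing over the even ranges [1 .. 2M] fixes the sign of the oscillating
term. *)
Lemma dirichlet_alternating (t : R) (M : nat) :
  cos t * (1 + psum (fun n => (-1) ^ n * (2 * cos (2 * INR n * t))) (2 * M))
  = cos ((4 * INR M + 1) * t).
Proof.
  induction M as [|M IH].
  - simpl (2 * 0)%nat. rewrite psum_0. simpl. rewrite Rplus_0_r, Rmult_1_r.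
    f_equal. ring.
  - rewrite psum_double_S. rewrite !Rplus_assoc, <- (Rplus_assoc 1).
    rewrite Rmult_plus_distr_l, IH.
    rewrite <- !tech_pow_Rmult, pow_neg1_double.
    rewrite !S_INR, mult_INR. replace (INR 2) with 2 by (simpl; ring).
    set (m := (4 * INR M + 1) * t).
    replace (2 * (2 * INR M + 1) * t) with (m + t) by (unfold m; ring).
    replace (2 * (2 * INR M + 1 + 1) * t) with (m + (t + (t + t)))
      by (unfold m; ring).
    replace ((4 * (INR M + 1) + 1) * t) with (m + (t + (t + (t + t))))
      by (unfold m; ring).
    repeat rewrite ?cos_plus, ?sin_plus.
    pose proof (sin2_cos2 t) as H. unfold Rsqr in H.
    set (s := sin t) in *. set (c := cos t) in *.
    set (X := cos m). set (Y := sin m).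
    assert (Hs : s * s + c * c = 1) by lra. clearbody s c X Y m. nsatz.
Qed.

(** After division by [2 sin t cos t] the non-oscillating part is
[24 cot t - 32 tan t]: [48 - 112 s^2 = 48 c^2 - 64 s^2] when
[s^2 + c^2 = 1].  The product form has no singularity at 0. *)
Lemma dirichlet_sine (t : R) (M : nat) :
  2 * sin t * cos t
  * psum (fun n => (48 + 64 * (-1) ^ n) * sin (2 * INR n * t)) (2 * M)
  = 48 - 112 * sin t ^ 2
    - (48 * cos t * cos ((4 * INR M + 1) * t)
       - 64 * sin t * sin ((4 * INR M + 1) * t)).
Proof.
  pose proof (sin2_cos2 t) as H. unfold Rsqr in H.
  induction M as [|M IH].
  - simpl (2 * 0)%nat. rewrite psum_0. simpl INR.
    replace ((4 * 0 + 1) * t) with t by ring.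
    set (s := sin t) in *. set (c := cos t) in *. clearbody s c. nra.
  - rewrite psum_double_S, !Rmult_plus_distr_l, IH.
    rewrite <- !tech_pow_Rmult, pow_neg1_double.
    rewrite !S_INR, mult_INR. replace (INR 2) with 2 by (simpl; ring).
    set (m := (4 * INR M + 1) * t).
    replace (2 * (2 * INR M + 1) * t) with (m + t) by (unfold m; ring).
    replace (2 * (2 * INR M + 1 + 1) * t) with (m + (t + (t + t)))
      by (unfold m; ring).
    replace ((4 * (INR M + 1) + 1) * t) with (m + (t + (t + (t + t))))
      by (unfold m; ring).
    repeat rewrite ?cos_plus, ?sin_plus. clear IH.
    set (s := sin t) in *. set (c := cos t) in *.
    set (X := cos m). set (Y := sin m).
    clearbody s c X Y m. nsatz.
Qed.

(** * The substitution x = 4 sin^2 t *)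

Lemma sin2_radius (t : R) : 0 <= t < PI / 2 -> Rabs (4 * sin t ^ 2) < 4.
Proof.
  intros Ht. assert (0 < cos t) by (apply cos_gt_0; lra).
  pose proof (sin2_cos2 t) as H2. unfold Rsqr in H2.
  rewrite Rabs_pos_eq; nra.
Qed.

Lemma is_derive_PSeries_sin2 (a : nat -> R) (t : R) :
  Rbar_lt (Rabs (4 * sin t ^ 2)) (CV_radius a) ->
  is_derive (fun s => PSeries a (4 * sin s ^ 2)) t
    (8 * sin t * cos t * PSeries (PS_derive a) (4 * sin t ^ 2)).
Proof.
  intros H. apply (is_derive_comp (PSeries a) (fun s => 4 * sin s ^ 2)).
  - apply is_derive_PSeries, H.
  - auto_derive; [exact I | ring].
Qed.

(** [rho t] is [t / sin 2t] (see [rho_spec]), extended smoothly through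
[t = 0]. *)
Definition rho (t : R) : R := PSeries inv_binom (4 * sin t ^ 2).
Definition drho (t : R) : R :=
  8 * sin t * cos t * PSeries (PS_derive inv_binom) (4 * sin t ^ 2).

Lemma is_derive_rho (t : R) : 0 <= t < PI / 2 -> is_derive rho t (drho t).
Proof.
  intros Ht. apply is_derive_PSeries_sin2, inv_binom_radius, sin2_radius, Ht.
Qed.

Lemma ex_derive_drho (t : R) : 0 <= t < PI / 2 -> ex_derive drho t.
Proof.
  intros Ht. unfold drho. apply @ex_derive_mult.
  - auto_derive. exact I.
  - eexists. apply is_derive_PSeries_sin2.
    rewrite CV_radius_derive. apply inv_binom_radius, sin2_radius, Ht.
Qed.

(** By [inv_binom_ode] the left side has derivative 1, and it vanishes at 0. *)
Lemma rho_spec (t : R) : 0 <= t < PI / 2 -> 2 * sin t * cos t * rho t = t.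
Proof.
  intros Ht.
  assert (H1 : forall s, 0 <= s <= t ->
                 is_derive (fun s => 2 * sin s * cos s * rho s) s 1).
  { intros s Hs. assert (Hs' : 0 <= s < PI / 2) by lra.
    pose proof (is_derive_rho s Hs') as Hd.
    auto_derive; [repeat split; eexists; exact Hd|].
    replace (Derive (fun x => rho x) s) with (drho s)
      by (symmetry; apply is_derive_unique, Hd).
    pose proof (inv_binom_ode _ (sin2_radius s Hs')) as Ho.
    pose proof (sin2_cos2 s) as H2. unfold Rsqr in H2.
    unfold drho, rho.
    set (u := PSeries inv_binom _) in *.
    set (v := PSeries (PS_derive inv_binom) _) in *.
    set (x := sin s) in *. set (y := cos s) in *.
    apply eq_trans with (2 := Ho). apply Rminus_diag_uniq.
    transitivity ((x * x + y * y - 1) * (2 * u + 16 * x ^ 2 * v)); [ring|].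
    rewrite H2. ring. }
  destruct (MVT_gen (fun s => 2 * sin s * cos s * rho s) 0 t (fun _ => 1))
    as (c & _ & Hc); rewrite ?Rmin_left, ?Rmax_right by lra.
  - intros s Hs. apply H1. lra.
  - intros s Hs. apply continuity_pt_filterlim.
    apply (ex_derive_continuous (fun s => 2 * sin s * cos s * rho s)).
    exists 1. apply H1, Hs.
  - rewrite sin_0 in Hc. lra.
Qed.

(** [PS_Int weighted] has coefficients [weight (k-1) inv_binom (k-1) / k], which
are those of the sum: this is [f (4 sin^2 t)]. *)
Definition lifted_sum (t : R) : R := PSeries (PS_Int weighted) (4 * sin t ^ 2).
Definition dlifted_sum (t : R) : R :=
  8 * sin t * cos t * PSeries weighted (4 * sin t ^ 2).

Lemma is_derive_lifted_sum (t : R) :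
  0 <= t < PI / 2 -> is_derive lifted_sum t (dlifted_sum t).
Proof.
  intros Ht. unfold lifted_sum, dlifted_sum.
  rewrite (PSeries_ext weighted (PS_derive (PS_Int weighted))).
  - apply is_derive_PSeries_sin2. rewrite CV_radius_Int.
    apply weighted_radius, sin2_radius, Ht.
  - intros n. unfold PS_derive, PS_Int. field. apply not_0_INR. lia.
Qed.

(** With [rho_spec] the right side is [24 t cot t - 32 t tan t]. *)
Lemma is_derive_dlifted_sum (t : R) : 0 <= t < PI / 2 ->
  is_derive dlifted_sum t (4 * (12 - 28 * sin t ^ 2) * rho t).
Proof.
  intros Ht. unfold dlifted_sum.
  pose proof (is_derive_PSeries_sin2 weighted t
    (weighted_radius _ (sin2_radius t Ht))) as Hd.
  set (f := fun s => PSeries weighted (4 * sin s ^ 2)) in Hd.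
  apply is_derive_ext with (fun s => 8 * sin s * cos s * f s); [reflexivity|].
  auto_derive; [repeat split; eexists; exact Hd|].
  replace (Derive (fun x => f x) t) with
    (8 * sin t * cos t * PSeries (PS_derive weighted) (4 * sin t ^ 2))
    by (symmetry; apply is_derive_unique, Hd).
  pose proof (weighted_ode _ (sin2_radius t Ht)) as Ho.
  pose proof (sin2_cos2 t) as H2. unfold Rsqr in H2.
  unfold rho, f. clear Hd f.
  set (z := PSeries inv_binom _) in *.
  set (u := PSeries weighted _) in *.
  set (v := PSeries (PS_derive weighted) _) in *.
  set (x := sin t) in *. set (y := cos t) in *.
  replace (4 * (12 - 28 * x ^ 2) * z) with (4 * ((12 - 7 * (4 * x ^ 2)) * z))
    by ring.
  rewrite <- Ho. apply Rminus_diag_uniq.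
  transitivity ((x * x + y * y - 1) * (8 * u + 64 * x ^ 2 * v)); [ring|].
  rewrite H2. ring.
Qed.

(** * Fourier expansions *)

Lemma is_lim_seq_of_error_bound (u : nat -> R) (l B : R) :
  (forall M, Rabs (l - u M) <= B / (4 * INR M + 1)) -> is_lim_seq u l.
Proof.
  intros H.
  assert (Hl : is_lim_seq (fun M => B / (4 * INR M + 1)) 0).
  { replace (Finite 0) with (Rbar_mult B (Rbar_inv p_infty))
      by (simpl; f_equal; ring).
    apply is_lim_seq_scal_l, is_lim_seq_inv; [|discriminate].
    apply is_lim_seq_le_p_loc with INR; [|apply is_lim_seq_INR].
    exists 0%nat. intros M _. pose proof (pos_INR M). lra. }
  apply is_lim_seq_ext with (fun M => l - (l - u M)); [intros; ring|].
  replace l with (l - 0) at 1 by ring.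
  apply is_lim_seq_minus'; [apply is_lim_seq_const|].
  apply is_lim_seq_abs_0.
  apply is_lim_seq_le_le with (3 := Hl) (u := fun _ => 0).
  - intros M. split; [apply Rabs_pos | apply H].
  - apply is_lim_seq_const.
Qed.

(** [J n] is the antiderivative of [(a - t) t sin 2nt] vanishing at 0, and
[lifted_sum t + (a - t) dlifted_sum t] is one of
[(a - t) (lifted_sum)''].  Subtracting from the latter the partial sum of the
[J n], with the coefficients of [dirichlet_sine], gives a [D] with purely
oscillating derivative, for which [D a - D 0] is the error of the expansion. *)
Lemma lifted_sum_fourier (a : R) : 0 <= a < PI / 2 ->
  is_lim_seq (fun M => psum (fun n => (12 + 16 * (-1) ^ n) *
      ((1 - cos (2 * INR n * a)) / INR n ^ 3
       - a * sin (2 * INR n * a) / INR n ^ 2)) (2 * M)) (lifted_sum a).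
Proof.
  intros Ha.
  destruct (riemann_lebesgue
    (fun t => 48 * (a - t) * rho t * cos t)
    (fun t => - 64 * (a - t) * rho t * sin t)
    (fun t => 48 * (- rho t * cos t + (a - t) * drho t * cos t
                    - (a - t) * rho t * sin t))
    (fun t => - 64 * (- rho t * sin t + (a - t) * drho t * sin t
                    + (a - t) * rho t * cos t)) a) as [B HB].
  - lra.
  - intros t Ht. assert (Ht' : 0 <= t < PI / 2) by lra.
    pose proof (is_derive_rho t Ht') as Hd.
    auto_derive; [repeat split; eexists; exact Hd|].
    replace (Derive (fun x => rho x) t) with (drho t)
      by (symmetry; apply is_derive_unique, Hd). ring.
  - intros t Ht. assert (Ht' : 0 <= t < PI / 2) by lra.
    pose proof (is_derive_rho t Ht') as Hd.
    auto_derive; [repeat split; eexists; exact Hd|].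
    replace (Derive (fun x => rho x) t) with (drho t)
      by (symmetry; apply is_derive_unique, Hd). ring.
  - intros t Ht. assert (Ht' : 0 <= t < PI / 2) by lra.
    pose proof (is_derive_rho t Ht') as Hd.
    pose proof (ex_derive_drho t Ht') as Hdd.
    apply @ex_derive_continuous.
    auto_derive; repeat split; solve [exact Hdd | eexists; exact Hd].
  - intros t Ht. assert (Ht' : 0 <= t < PI / 2) by lra.
    pose proof (is_derive_rho t Ht') as Hd.
    pose proof (ex_derive_drho t Ht') as Hdd.
    apply @ex_derive_continuous.
    auto_derive; repeat split; solve [exact Hdd | eexists; exact Hd].
  - apply is_lim_seq_of_error_bound with B. intros M.
    set (J := fun (n : nat) (t : R) =>
      - (a * t - t ^ 2) * cos (2 * INR n * t) / (2 * INR n)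
      + (a - 2 * t) * sin (2 * INR n * t) / (2 * INR n) ^ 2
      + 2 * (1 - cos (2 * INR n * t)) / (2 * INR n) ^ 3).
    set (D := fun t => lifted_sum t + (a - t) * dlifted_sum t
      - psum (fun n => (48 + 64 * (-1) ^ n) * J n t) (2 * M)).
    replace (lifted_sum a - _) with (D a - D 0).
    + apply HB; [pose proof (pos_INR M); lra|]. intros t Ht.
      assert (Ht' : 0 <= t < PI / 2) by lra.
      assert (HJ : forall n, (1 <= n)%nat ->
        is_derive (fun s => (48 + 64 * (-1) ^ n) * J n s) t
          ((48 + 64 * (-1) ^ n) * ((a - t) * t * sin (2 * INR n * t)))).
      { intros n Hn. apply lt_0_INR in Hn. apply @is_derive_scal.
        unfold J. auto_derive; [exact I | field; lra]. }
      pose proof (is_derive_psum (fun n s => (48 + 64 * (-1) ^ n) * J n s)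
        (fun n t =>
        (48 + 64 * (-1) ^ n) * ((a - t) * t * sin (2 * INR n * t)))
        t (2 * M) HJ) as HS.
      pose proof (is_derive_lifted_sum t Ht') as HP.
      pose proof (is_derive_dlifted_sum t Ht') as HdP.
      assert (HT : is_derive (fun t => lifted_sum t + (a - t) * dlifted_sum t) t
        ((a - t) * (4 * (12 - 28 * sin t ^ 2) * rho t))).
      { auto_derive; [repeat split; eexists; eassumption|].
        replace (Derive (fun x => lifted_sum x) t) with (dlifted_sum t)
          by (symmetry; apply is_derive_unique, HP).
        replace (Derive (fun x => dlifted_sum x) t)
          with (4 * (12 - 28 * sin t ^ 2) * rho t)
          by (symmetry; apply is_derive_unique, HdP). ring. }
      eapply eq_rect; [exact (is_derive_minus _ _ _ _ _ HT HS)|].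
      unfold minus, plus, opp; cbn -[psum Nat.mul pow INR].
      rewrite (psum_ext _ (fun n => (a - t) * t *
        ((48 + 64 * (-1) ^ n) * sin (2 * INR n * t)))) by (intros; ring).
      rewrite psum_scal.
      pose proof (dirichlet_sine t M) as Hk.
      pose proof (rho_spec t Ht') as Hr.
      set (F := psum _ _) in Hk |- *.
      replace ((a - t) * t * F)
        with ((a - t) * rho t * (2 * sin t * cos t * F))
        by (transitivity ((a - t) * (2 * sin t * cos t * rho t) * F);
            [| rewrite Hr]; ring).
      rewrite Hk. ring.
    + assert (H0 : D 0 = 0).
      { unfold D, J, lifted_sum, dlifted_sum. rewrite sin_0.
        rewrite (psum_ext _ (fun n => 0 * 0)).
        - rewrite psum_scal. rewrite pow_i by lia.
          rewrite Rmult_0_r. rewrite PSeries_0. unfold PS_Int. ring.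
        - intros n Hn. apply lt_0_INR in Hn.
          rewrite !Rmult_0_r, sin_0, cos_0. field. lra. }
      rewrite H0. unfold D.
      rewrite (psum_ext _ (fun n => (12 + 16 * (-1) ^ n) *
        ((1 - cos (2 * INR n * a)) / INR n ^ 3
         - a * sin (2 * INR n * a) / INR n ^ 2))).
      * ring.
      * intros n Hn. apply lt_0_INR in Hn. unfold J. field. lra.
Qed.

(** The same argument for
[- a^2 = - int_0^a 2 (a - t) dt] and the kernel [cos((4M+1)t) / cos t], which
is smooth on [0, a]. *)
Lemma square_fourier (a : R) : 0 <= a < PI / 2 ->
  is_lim_seq (fun M => psum (fun n => (-1) ^ n *
      ((1 - cos (2 * INR n * a)) / INR n ^ 2)) (2 * M)) (- a ^ 2).
Proof.
  intros Ha.
  destruct (riemann_lebesgue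
    (fun t => 2 * (a - t) / cos t) (fun _ => 0)
    (fun t => 2 * (- cos t + (a - t) * sin t) / cos t ^ 2) (fun _ => 0) a)
    as [B HB].
  - lra.
  - intros t Ht. assert (0 < cos t) by (apply cos_gt_0; lra).
    auto_derive; [lra | field; lra].
  - intros. apply @is_derive_const.
  - intros t Ht. assert (0 < cos t) by (apply cos_gt_0; lra).
    apply @ex_derive_continuous. auto_derive. nra.
  - intros. apply continuous_const.
  - apply is_lim_seq_of_error_bound with B. intros M.
    set (J := fun (n : nat) (t : R) =>
      2 * (a - t) * sin (2 * INR n * t) / INR n
      + (1 - cos (2 * INR n * t)) / INR n ^ 2).
    set (D := fun t => psum (fun n => (-1) ^ n * J n t) (2 * M)
                       + (2 * a * t - t ^ 2)).
    replace (- a ^ 2 - _) with (- (D a - D 0)).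
    + rewrite Rabs_Ropp.
      apply HB; [pose proof (pos_INR M); lra|]. intros t Ht.
      assert (Hc : 0 < cos t) by (apply cos_gt_0; lra).
      assert (HJ : forall n, (1 <= n)%nat ->
        is_derive (fun s => (-1) ^ n * J n s) t
          ((-1) ^ n * (4 * (a - t) * cos (2 * INR n * t)))).
      { intros n Hn. apply lt_0_INR in Hn. apply @is_derive_scal.
        unfold J. auto_derive; [exact I | field; lra]. }
      pose proof (is_derive_psum (fun n s => (-1) ^ n * J n s) (fun n t =>
        (-1) ^ n * (4 * (a - t) * cos (2 * INR n * t))) t (2 * M) HJ) as HS.
      assert (HT : is_derive (fun t => 2 * a * t - t ^ 2) t (2 * (a - t)))
        by (auto_derive; [exact I | ring]).
      eapply eq_rect; [exact (is_derive_plus _ _ _ _ _ HS HT)|].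
      unfold plus; cbn -[psum Nat.mul pow INR].
      rewrite (psum_ext _ (fun n => 2 * (a - t) *
        ((-1) ^ n * (2 * cos (2 * INR n * t))))) by (intros; ring).
      rewrite psum_scal, <- dirichlet_alternating. field. lra.
    + unfold D. rewrite (psum_ext (fun n => _ * J n 0) (fun n => 0 * 0)).
      * rewrite psum_scal.
        rewrite (psum_ext (fun n => _ * J n a) (fun n => (-1) ^ n *
          ((1 - cos (2 * INR n * a)) / INR n ^ 2))); [ring|].
        intros n Hn. apply lt_0_INR in Hn. unfold J. field. lra.
      * intros n Hn. apply lt_0_INR in Hn. unfold J.
        rewrite !Rmult_0_r, sin_0, cos_0. field. lra.
Qed.

(** * Convergence and rearrangement of the limiting series *)

(** Comparison with the telescoping sum of [1 / (n (n+1))]. *)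
Lemma ex_series_inv_sq : ex_series (fun n => / INR (S n) ^ 2).
Proof.
  apply ex_finite_lim_seq_incr with 2.
  - intros n. rewrite sum_Sn. unfold plus; cbn -[pow INR sum_n].
    assert (0 < / INR (S (S n)) ^ 2)
      by (apply Rinv_0_lt_compat, pow_lt, lt_0_INR; lia). lra.
  - intros n. apply Rle_trans with (2 - / INR (S n)).
    + induction n as [|n IH].
      * rewrite sum_O. simpl. lra.
      * rewrite sum_Sn. unfold plus; cbn -[pow INR sum_n].
        assert (Hn : 0 < INR (S n)) by (apply lt_0_INR; lia).
        rewrite (S_INR (S n)). set (x := INR (S n)) in *.
        assert (/ x - / (x + 1) - / (x + 1) ^ 2 = / (x * (x + 1) ^ 2))
          by (field; lra).
        assert (0 < / (x * (x + 1) ^ 2))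
          by (apply Rinv_0_lt_compat, Rmult_lt_0_compat, pow_lt; lra).
        lra.
    + assert (0 < / INR (S n)) by (apply Rinv_0_lt_compat, lt_0_INR; lia). lra.
Qed.

Lemma ex_series_le_inv_sq (f : nat -> R) (c : R) :
  (forall n, Rabs (f n) <= c * / INR (S n) ^ 2) -> ex_series f.
Proof.
  intros H. apply @ex_series_le with (1 := H).
  apply (ex_series_scal_l c (fun n => / INR (S n) ^ 2)), ex_series_inv_sq.
Qed.

Lemma is_lim_seq_psum (f : nat -> R) (k : nat) :
  (0 < k)%nat -> ex_series (fun n => f (S n)) ->
  is_lim_seq (fun M => psum f (k * M)) (Series (fun n => f (S n))).
Proof.
  intros Hk H.
  apply (is_lim_seq_subseq (psum f) _ (fun M => (k * M)%nat)).
  - apply eventually_subseq. intros n. nia.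
  - apply is_lim_seq_incr_1.
    apply is_lim_seq_ext with (sum_n (fun n => f (S n))).
    + intros n. apply (sum_n_m_S f 0 n).
    + apply Series_correct, H.
Qed.

Lemma psum_alternating (f : nat -> R) (M : nat) :
  psum (fun n => (-1) ^ n * f n) (2 * M)
  = 2 * psum (fun n => f (2 * n)%nat) M - psum f (2 * M).
Proof.
  induction M as [|M IH].
  - simpl (2 * 0)%nat. rewrite !psum_0. ring.
  - rewrite !psum_double_S, IH, psum_S, <- !tech_pow_Rmult, pow_neg1_double.
    replace (2 * S M)%nat with (S (S (2 * M))) by lia. ring.
Qed.

(** When [f] is an eigenvector of [n |-> 2n], its alternating series is a
multiple of its plain one. *)
Lemma is_lim_seq_psum_alternating (f : nat -> R) (c : R) :
  ex_series (fun n => f (S n)) ->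
  (forall n, (1 <= n)%nat -> f (2 * n)%nat = c * f n) ->
  is_lim_seq (fun M => psum (fun n => (-1) ^ n * f n) (2 * M))
    ((2 * c - 1) * Series (fun n => f (S n))).
Proof.
  intros Hf Hc.
  apply is_lim_seq_ext with
    (fun M => 2 * c * psum f (1 * M) - psum f (2 * M)).
  - intros M. rewrite psum_alternating.
    rewrite (psum_ext (fun n => f (2 * n)%nat) _ M Hc), psum_scal, Nat.mul_1_l.
    ring.
  - rewrite Rmult_minus_distr_r, Rmult_1_l.
    apply is_lim_seq_minus'.
    + apply (is_lim_seq_scal_l _ (2 * c) (Series (fun n => f (S n)))).
      apply is_lim_seq_psum; [lia | exact Hf].
    + apply is_lim_seq_psum; [lia | exact Hf].
Qed.

Lemma Series_triple (f : nat -> R) :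
  ex_series (fun n => f (S n)) ->
  is_series
    (fun i => f (3 * i + 1)%nat + f (3 * i + 2)%nat + f (3 * i + 3)%nat)
    (Series (fun n => f (S n))).
Proof.
  intros H.
  apply (is_lim_seq_ext (fun M => psum f (3 * S M)) (sum_n _)
           (Series (fun n => f (S n)))).
  - intros M.
    assert (Hs : forall M, psum f (3 * S M) = psum f (3 * M)
      + (f (3 * M + 1)%nat + f (3 * M + 2)%nat + f (3 * M + 3)%nat)).
    { intros N. replace (3 * S N)%nat with (S (S (S (3 * N)))) by lia.
      rewrite !psum_S, <- !Rplus_assoc.
      repeat f_equal; lia. }
    induction M as [|M IH].
    + rewrite sum_O, Hs. change (3 * 0)%nat with 0%nat.
      rewrite psum_0. apply Rplus_0_l.
    + rewrite sum_Sn, <- IH. apply Hs.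
  - apply (is_lim_seq_incr_1 (fun M => psum f (3 * M))).
    apply is_lim_seq_psum; [lia | exact H].
Qed.

(** * Evaluation at PI / 3 *)

Lemma cos_sin_third (i : nat) :
  (cos (2 * INR (3 * i + 1) * (PI / 3)) = - / 2
   /\ sin (2 * INR (3 * i + 1) * (PI / 3)) = sqrt 3 / 2)
  /\ (cos (2 * INR (3 * i + 2) * (PI / 3)) = - / 2
   /\ sin (2 * INR (3 * i + 2) * (PI / 3)) = - (sqrt 3 / 2))
  /\ (cos (2 * INR (3 * i + 3) * (PI / 3)) = 1
   /\ sin (2 * INR (3 * i + 3) * (PI / 3)) = 0).
Proof.
  assert (H3 : sqrt 3 * sqrt 3 = 3) by (apply sqrt_sqrt; lra).
  rewrite !plus_INR, mult_INR. simpl (INR 1).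
  replace (INR 2) with 2 by (simpl; ring).
  replace (INR 3) with 3 by (simpl; ring).
  replace (2 * (3 * INR i + 1) * (PI / 3))
    with (2 * (PI / 3) + 2 * INR i * PI) by field.
  replace (2 * (3 * INR i + 2) * (PI / 3))
    with (2 * (2 * (PI / 3)) + 2 * INR i * PI) by field.
  replace (2 * (3 * INR i + 3) * (PI / 3))
    with (0 + 2 * INR (S i) * PI) by (rewrite S_INR; field).
  rewrite !cos_period, !sin_period, (cos_2a (2 * (PI / 3))),
    (sin_2a (2 * (PI / 3))), cos_2PI3, sin_2PI3.
  rewrite cos_0, sin_0.
  repeat split; try lra; nra.
Qed.

Lemma double_third (n : nat) :
  cos (2 * INR (2 * n) * (PI / 3)) = cos (2 * INR n * (PI / 3))
  /\ sin (2 * INR (2 * n) * (PI / 3)) = - sin (2 * INR n * (PI / 3)).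
Proof.
  replace (2 * INR (2 * n) * (PI / 3))
    with (- (2 * INR n * (PI / 3)) + 2 * INR n * PI)
    by (rewrite mult_INR; simpl; field).
  rewrite cos_period, sin_period, cos_neg, sin_neg. split; reflexivity.
Qed.

Definition cos_term2 (n : nat) : R :=
  (1 - cos (2 * INR n * (PI / 3))) / INR n ^ 2.
Definition cos_term3 (n : nat) : R :=
  (1 - cos (2 * INR n * (PI / 3))) / INR n ^ 3.
Definition sin_term2 (n : nat) : R :=
  sin (2 * INR n * (PI / 3)) / INR n ^ 2.

Lemma ex_series_trig (f : nat -> R) (c : nat -> R) :
  (forall n, Rabs (c n) <= 2) ->
  (forall n, Rabs (f (S n)) <= Rabs (c n / INR (S n) ^ 2)) ->
  ex_series (fun n => f (S n)).
Proof.
  intros Hc Hf. apply ex_series_le_inv_sq with 2. intros n.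
  apply Rle_trans with (1 := Hf n). unfold Rdiv. rewrite Rabs_mult.
  assert (0 < / INR (S n) ^ 2)
    by (apply Rinv_0_lt_compat, pow_lt, lt_0_INR; lia).
  rewrite (Rabs_pos_eq (/ _)) by lra. apply Rmult_le_compat_r; [lra | apply Hc].
Qed.

Lemma one_minus_cos_bound (x : R) : Rabs (1 - cos x) <= 2.
Proof. apply Rabs_le. pose proof (COS_bound x). lra. Qed.

Lemma ex_series_cos_term2 : ex_series (fun n => cos_term2 (S n)).
Proof.
  apply ex_series_trig with (fun n => 1 - cos (2 * INR (S n) * (PI / 3))).
  - intros n. apply one_minus_cos_bound.
  - intros n. apply Rle_refl.
Qed.

Lemma ex_series_sin_term2 : ex_series (fun n => sin_term2 (S n)).
Proof.
  apply ex_series_trig with (fun n => sin (2 * INR (S n) * (PI / 3))).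
  - intros n. apply Rabs_le. pose proof (SIN_bound (2 * INR (S n) * (PI / 3))).
    lra.
  - intros n. apply Rle_refl.
Qed.

Lemma ex_series_cos_term3 : ex_series (fun n => cos_term3 (S n)).
Proof.
  apply ex_series_trig with
    (fun n => (1 - cos (2 * INR (S n) * (PI / 3))) / INR (S n)).
  - intros n. assert (H : 1 <= INR (S n)).
    { rewrite S_INR. pose proof (pos_INR n). lra. }
    unfold Rdiv. rewrite Rabs_mult, (Rabs_pos_eq (/ _)).
    + pose proof (one_minus_cos_bound (2 * INR (S n) * (PI / 3))).
      assert (/ INR (S n) <= 1)
        by (rewrite <- Rinv_1; apply Rinv_le_contravar; lra).
      assert (0 < / INR (S n)) by (apply Rinv_0_lt_compat; lra).
      pose proof (Rabs_pos (1 - cos (2 * INR (S n) * (PI / 3)))).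
      unfold Rdiv in *. nra.
    + left. apply Rinv_0_lt_compat. lra.
  - intros n. right. f_equal. unfold cos_term3. field. apply not_0_INR. lia.
Qed.

Definition alpha (i : nat) : R := 1 / (1 + 3 * INR i) ^ 2.
Definition beta (i : nat) : R := 1 / (2 + 3 * INR i) ^ 2.

Lemma ex_series_sq_progression (c : R) :
  1 <= c -> ex_series (fun i => 1 / (c + 3 * INR i) ^ 2).
Proof.
  intros Hc. apply ex_series_le_inv_sq with 1. intros n.
  pose proof (pos_INR n). rewrite S_INR.
  unfold Rdiv. rewrite !Rmult_1_l, Rabs_pos_eq.
  - apply Rinv_le_contravar; [apply pow_lt; lra|].
    apply pow_incr. lra.
  - left. apply Rinv_0_lt_compat, pow_lt. lra.
Qed.

Lemma Series_alpha : Series alpha = 1 + Defs.c1.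
Proof.
  rewrite Series_incr_1 by (apply ex_series_sq_progression; lra).
  unfold Defs.c1, alpha. f_equal. simpl. field.
Qed.

Lemma Series_cos_term2 :
  Series (fun n => cos_term2 (S n)) = 3 / 2 * (Series alpha + Series beta).
Proof.
  symmetry. rewrite <- Series_plus by (apply ex_series_sq_progression; lra).
  rewrite <- Series_scal_l.
  rewrite <- (is_series_unique _ _ (Series_triple cos_term2
    ex_series_cos_term2)).
  apply Series_ext. intros i. unfold cos_term2.
  destruct (cos_sin_third i) as ((-> & _) & (-> & _) & (-> & _)).
  rewrite !plus_INR, mult_INR. simpl (INR 1).
  replace (INR 2) with 2 by (simpl; ring).
  replace (INR 3) with 3 by (simpl; ring).
  pose proof (pos_INR i). unfold alpha, beta. field. lra.
Qed.

Lemma Series_sin_term2 :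
  Series (fun n => sin_term2 (S n))
  = sqrt 3 / 2 * (Series alpha - Series beta).
Proof.
  symmetry. rewrite <- Series_minus by (apply ex_series_sq_progression; lra).
  rewrite <- Series_scal_l.
  rewrite <- (is_series_unique _ _ (Series_triple sin_term2
    ex_series_sin_term2)).
  apply Series_ext. intros i. unfold sin_term2.
  destruct (cos_sin_third i) as ((_ & ->) & (_ & ->) & (_ & ->)).
  rewrite !plus_INR, mult_INR. simpl (INR 1).
  replace (INR 2) with 2 by (simpl; ring).
  replace (INR 3) with 3 by (simpl; ring).
  pose proof (pos_INR i). unfold alpha, beta. field. lra.
Qed.

Lemma is_lim_seq_unique_R (u : nat -> R) (l l' : R) :
  is_lim_seq u l -> is_lim_seq u l' -> l = l'.
Proof.
  intros H H'. apply is_lim_seq_unique in H. apply is_lim_seq_unique in H'.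
  congruence.
Qed.

Lemma third_range : 0 <= PI / 3 < PI / 2.
Proof. pose proof PI_RGT_0. lra. Qed.

(** The two evaluations of [sum_n (-1)^n (1 - cos(2 n PI/3)) / n^2], namely
[- PI^2 / 9] and minus half of the plain sum [3/2 (alpha + beta)]. *)
Lemma Series_alpha_plus_beta : Series alpha + Series beta = 4 * PI ^ 2 / 27.
Proof.
  pose proof (is_lim_seq_unique_R _ _ _ (square_fourier _ third_range)
    (is_lim_seq_psum_alternating cos_term2 (/ 4) ex_series_cos_term2
      ltac:(intros n Hn; apply lt_0_INR in Hn; unfold cos_term2;
            destruct (double_third n) as [-> _]; rewrite mult_INR;
            replace (INR 2) with 2 by (simpl; ring); field; lra))) as H.
  rewrite Series_cos_term2 in H. lra.
Qed.

(** The doubling factors are [1/8] for the cubic terms and [-1/4] for the sine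
terms: the former cancel, as [12 + 16 (2/8 - 1) = 0], and the latter keep
[-(PI/3) (12 + 16 (-2/4 - 1)) = 4 PI]. *)
Lemma lifted_sum_third :
  lifted_sum (PI / 3) = 4 * PI * Series (fun n => sin_term2 (S n)).
Proof.
  apply (is_lim_seq_unique_R _ _ _ (lifted_sum_fourier _ third_range)).
  assert (A3 : is_lim_seq (fun M =>
      psum (fun n => (-1) ^ n * cos_term3 n) (2 * M))
                 ((2 * / 8 - 1) * Series (fun n => cos_term3 (S n)))).
  { apply is_lim_seq_psum_alternating; [exact ex_series_cos_term3|].
    intros n Hn. apply lt_0_INR in Hn. unfold cos_term3.
    destruct (double_third n) as [-> _]. rewrite mult_INR.
    replace (INR 2) with 2 by (simpl; ring). field. lra. }
  assert (Av : is_lim_seq (fun M =>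
      psum (fun n => (-1) ^ n * sin_term2 n) (2 * M))
                 ((2 * - / 4 - 1) * Series (fun n => sin_term2 (S n)))).
  { apply is_lim_seq_psum_alternating; [exact ex_series_sin_term2|].
    intros n Hn. apply lt_0_INR in Hn. unfold sin_term2.
    destruct (double_third n) as [_ ->]. rewrite mult_INR.
    replace (INR 2) with 2 by (simpl; ring). field. lra. }
  pose proof (is_lim_seq_psum cos_term3 2 ltac:(lia) ex_series_cos_term3) as S3.
  pose proof (is_lim_seq_psum sin_term2 2 ltac:(lia) ex_series_sin_term2) as Sv.
  set (U := Series (fun n => cos_term3 (S n))) in *.
  set (V := Series (fun n => sin_term2 (S n))) in *.
  replace (4 * PI * V) with
    (12 * U - 12 * (PI / 3) * V
     + (16 * ((2 * / 8 - 1) * U) - 16 * (PI / 3) * ((2 * - / 4 - 1) * V)))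
    by field.
  apply is_lim_seq_ext with (fun M =>
    12 * psum cos_term3 (2 * M) - 12 * (PI / 3) * psum sin_term2 (2 * M)
    + (16 * psum (fun n => (-1) ^ n * cos_term3 n) (2 * M)
       - 16 * (PI / 3) * psum (fun n => (-1) ^ n * sin_term2 n) (2 * M))).
  - intros M. induction (2 * M)%nat as [|N IH].
    + rewrite !psum_0. ring.
    + rewrite !psum_S, <- IH.
      unfold cos_term3, sin_term2. field. apply not_0_INR. lia.
  - apply is_lim_seq_plus'; apply is_lim_seq_minus'.
    + apply (is_lim_seq_scal_l _ 12 U), S3.
    + apply (is_lim_seq_scal_l _ (12 * (PI / 3)) V), Sv.
    + exact (is_lim_seq_scal_l _ 16 _ A3).
    + exact (is_lim_seq_scal_l _ (16 * (PI / 3)) _ Av).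
Qed.

Theorem mainTheorem13 :
  is_series (fun n : nat => summand (S n)) (2 * sqrt 3 * PI * K).
Proof.
  replace (2 * sqrt 3 * PI * K) with (lifted_sum (PI / 3)).
  2:{ rewrite lifted_sum_third, Series_sin_term2.
      pose proof Series_alpha_plus_beta as H.
      rewrite Series_alpha in *. unfold K.
      replace (Series beta) with (4 * PI ^ 2 / 27 - (1 + Defs.c1))
        by lra. field. }
  assert (H : is_pseries (PS_Int weighted) (4 * sin (PI / 3) ^ 2)
                (lifted_sum (PI / 3))).
  { apply PSeries_correct, CV_radius_inside. rewrite CV_radius_Int.
    apply weighted_radius, sin2_radius, third_range. }
  (* The substitution sends the angle PI/3 to the argument 3. *)
  replace (4 * sin (PI / 3) ^ 2) with 3 in H.
  2:{ rewrite sin_PI3. simpl.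
      assert (H3 : sqrt 3 * sqrt 3 = 3) by (apply sqrt_sqrt; lra). nra. }
  apply is_pseries_R in H.
  apply is_series_ext with (fun n => PS_Int weighted (S n) * 3 ^ S n).
  - intros n.
    change (weight n * inv_binom n / INR (S n) * 3 ^ S n = summand (S n) :> R).
    unfold summand, weight, inv_binom.
    pose proof (central_binomial_pos (S n)).
    pose proof (lt_0_INR (S n) (Nat.lt_0_succ n)). field. lra.
  - apply (is_series_incr_1 (fun n => PS_Int weighted n * 3 ^ n)).
    assert (E : lifted_sum (PI / 3) = lifted_sum (PI / 3) + 0 * 3 ^ 0) by ring.
    rewrite E in H. exact H.
Qed.
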